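(* Let $J_k^{\mathrm{QN}}=\nabla F_1(v_k)+B_k$ with matrices $B_k\in\mathbb R^{d\times d}$, and let $H_k=R_k-B_k$ where $R_k=\nabla F(v_k)-\nabla F_1(v_k)$. Suppose $\|H_k\|_{\mathrm{op}}\le\delta_{\mathrm{QN}}$ at every outer iteration, and run the outer scheme described in the context for $T\ge1$ iterations with surrogate $J_k=J_k^{\mathrm{QN}}$ (without any directional certificate), model level $\delta=\delta_{\mathrm{QN}}$ and dual-step parameter $\rho_k=\delta_{\mathrm{QN}}$. Then $$\mathrm{Gap}(\widetilde z_T)\le\frac{16\sqrt2\,L_1D^3}{T^{3/2}}+\frac{16\sqrt2\,\delta_{\mathrm{QN}}D^2}{T}.$$ For the projected approximation $B_k=\Pi^{\mathrm F}_{\mathcal B_\beta}(YS^\dagger)$ built from stored residual secants, one may take $\delta_{\mathrm{QN}}=2\beta$, hence $$\mathrm{Gap}(\widetilde z_T)\le\frac{16\sqrt2\,L_1D^3}{T^{3/2}}+\frac{32\sqrt2\,\beta D^2}{T}.$$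
   Context: Norms are Euclidean; $\|\cdot\|_{\mathrm{op}}$ is the operator norm. $\mathcal Z\subset\mathbb R^d$ is nonempty, compact and convex with diameter $D$. $F=\sum_{i=1}^M w_iF_i$ with $w_i>0$, $\sum_i w_i=1$, all $F_i:\mathcal Z\to\mathbb R^d$ continuously differentiable. $F$ is monotone: $\langle F(x)-F(y),x-y\rangle\ge0$ for all $x,y\in\mathcal Z$; and $\|\nabla F(x)-\nabla F(y)\|_{\mathrm{op}}\le L_1\|x-y\|$ for all $x,y\in\mathcal Z$, $L_1>0$. $\beta=\sup_{z\in\mathcal Z}\|\nabla F(z)-\nabla F_1(z)\|_{\mathrm{op}}$. $\mathrm{Gap}(\widehat z)=\sup_{z\in\mathcal Z}\langle F(z),\widehat z-z\rangle$. $G:=F-F_1$. Stored residual secants: finitely many pairs $s_j=b_j-a_j$, $y_j=G(b_j)-G(a_j)$ with $a_j,b_j\in\mathcal Z$, $j=1,\dots,m$ (they may change with $k$); $S=[s_1,\dots,s_m]$, $Y=[y_1,\dots,y_m]$; $S^\dagger$ is the Moore--Penrose pseudoinverse ($YS^\dagger$ is read as $0$ if $m=0$). $\mathcal B_\beta=\{B\in\mathbb R^{d\times d}:\|B\|_{\mathrm{op}}\le\beta\}$ and $\Pi^{\mathrm F}_{\mathcal B_\beta}$ is the metric projection onto it in the Frobenius norm. Outer scheme (VIJI) with surrogates $J_k\in\mathbb R^{d\times d}$, model level $\delta\ge0$ and dual-step parameters $\rho_k\ge0$. Choose $z_0\in\mathcal Z$, $\sigma_0=0\in\mathbb R^d$.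 For $k=0,\dots,T-1$: (1) $v_k=\arg\max_{v\in\mathcal Z}\{\langle\sigma_k,v-z_0\rangle-\frac12\|v-z_0\|^2\}$; (2) take any $x_k\in\mathcal Z$ with $$\sup_{z\in\mathcal Z}\langle\Omega_{v_k,J_k,\delta}(x_k),x_k-z\rangle\le\frac{L_1}{2}\|x_k-v_k\|^3+\delta\|x_k-v_k\|^2,$$ where $\Omega_{v,J,\delta}(x)=F(v)+J(x-v)+(10\delta+5L_1\|x-v\|)(x-v)$; (3) choose $\lambda_k>0$ with $\frac1{32}\le\lambda_k\left(\frac{L_1}{2}\|x_k-v_k\|+\rho_k\right)\le\frac1{22}$; (4) $\sigma_{k+1}=\sigma_k-\lambda_kF(x_k)$. Output $\widetilde z_T=\left(\sum_{k=0}^{T-1}\lambda_k\right)^{-1}\sum_{k=0}^{T-1}\lambda_kx_k$. If the bracket in (3) is zero, the scheme stops and outputs $\widetilde z_T:=x_k$. *)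

(* Defs.v *)
From HB Require Import structures.
From mathcomp Require Import all_boot all_order all_algebra.
From mathcomp Require Import all_classical all_reals all_analysis.

Set Implicit Arguments.
Unset Strict Implicit.
Unset Printing Implicit Defensive.

Import Order.TTheory GRing.Theory Num.Theory.
Import numFieldNormedType.Exports.

Local Open Scope classical_set_scope.
Local Open Scope ring_scope.

Section Euclidean.
Context {R : realType}.

Definition dot {d} (u v : 'cV[R]_d) : R := \sum_i u i 0 * v i 0.

(* The library norm of matrices is the max norm; it induces the same topology
   as the two norms below, so compactness and continuity are the library's. *)
Definition frobenius {m n} (A : 'M[R]_(m, n)) : R :=
  Num.sqrt (\sum_i \sum_j A i j ^+ 2).

Definition enorm {d} (u : 'cV[R]_d) : R := Num.sqrt (dot u u).

(* [sup] is real-valued and 0 on sets without supremum.  This never occurs for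
   the suprema below when Z is nonempty and compact and the operators and
   Jacobians are continuous on Z: the sets are then nonempty and bounded. *)
Definition opnorm {m n} (A : 'M[R]_(m, n)) : R :=
  sup [set enorm (A *m u) | u in [set u : 'cV[R]_n | enorm u <= 1]].

Definition diameter {d} (Z : set 'cV[R]_d) : R :=
  sup [set enorm (p.1 - p.2) | p in Z `*` Z].

(* The four Penrose equations, characterizing X as the pseudoinverse of A. *)
Definition moore_penrose {m n} (A : 'M[R]_(m, n)) (X : 'M[R]_(n, m)) : Prop :=
  [/\ A *m X *m A = A, X *m A *m X = X,
      (A *m X)^T = A *m X & (X *m A)^T = X *m A].

Definition opball {d} (r : R) : set 'M[R]_d := [set B | opnorm B <= r].

Definition frobenius_projection {d} (C : set 'M[R]_d) (A P : 'M[R]_d) : Prop :=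
  C P /\ forall Q, C Q -> frobenius (A - P) <= frobenius (A - Q).

End Euclidean.

Section Operators.
Context {R : realType} {d : nat}.
Implicit Types (Z : set 'cV[R]_d) (F : 'cV[R]_d -> 'cV[R]_d).

(* Operators on Z are total functions of which only the values on Z matter.
   DF z is the Jacobian matrix of F at z relative to Z: the first-order
   expansion is only required along points of Z, so that nothing is assumed
   about F off Z.  It determines DF when Z has nonempty interior; otherwise DF
   is any continuous choice of derivative. *)
Definition C1_on Z F (DF : 'cV[R]_d -> 'M[R]_d) : Prop :=
  (forall z, Z z -> forall e : R, 0 < e ->
     \forall y \near within Z (nbhs z),
       enorm (F y - F z - DF z *m (y - z)) <= e * enorm (y - z)) /\
  {within Z, continuous DF}.

(* Used both for the operators F_i and for their Jacobians. *)
Definition mixture {V : lmodType R} {n} (w : 'I_n -> R)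
    (f : 'I_n -> 'cV[R]_d -> V) (z : 'cV[R]_d) : V :=
  \sum_i w i *: f i z.

Definition monotone_on Z F : Prop :=
  forall x y, Z x -> Z y -> 0 <= dot (F x - F y) (x - y).

Definition jacobian_lipschitz_on Z (DF : 'cV[R]_d -> 'M[R]_d) (L : R) : Prop :=
  forall x y, Z x -> Z y -> opnorm (DF x - DF y) <= L * enorm (x - y).

Definition dissimilarity Z (DF DF1 : 'cV[R]_d -> 'M[R]_d) : R :=
  sup [set opnorm (DF z - DF1 z) | z in Z].

Definition gap Z F (zhat : 'cV[R]_d) : R :=
  sup [set dot (F z) (zhat - z) | z in Z].

(* secants id a b is S and secants G a b is Y. *)
Definition secants F {m} (a b : 'I_m -> 'cV[R]_d) : 'M[R]_(d, m) :=
  \matrix_(i, j) (F (b j) - F (a j)) i 0.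

(* B is the projection onto opball beta of Y S^+, for some stored residual
   secants; m = 0 is allowed and then Y S^+ = 0. *)
Definition projected_secant_approx Z (G : 'cV[R]_d -> 'cV[R]_d) (beta : R)
    (B : 'M[R]_d) : Prop :=
  exists (m : nat) (a b : 'I_m -> 'cV[R]_d) (Sp : 'M[R]_(m, d)),
    [/\ forall j, Z (a j) /\ Z (b j),
        moore_penrose (secants id a b) Sp
      & frobenius_projection (opball beta) (secants G a b *m Sp) B].

End Operators.

Section Scheme.
Context {R : realType} {d : nat}.
Variables (Z : set 'cV[R]_d) (F : 'cV[R]_d -> 'cV[R]_d) (L1 delta : R).
Variables (rho : nat -> R) (J : nat -> 'M[R]_d) (z0 : 'cV[R]_d).
Variables (sigma v x : nat -> 'cV[R]_d) (lambda : nat -> R).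

Definition viji_model (u : 'cV[R]_d) (A : 'M[R]_d) (y : 'cV[R]_d) : 'cV[R]_d :=
  F u + A *m (y - u) + (10 * delta + 5 * L1 * enorm (y - u)) *: (y - u).

Definition viji_objective (s u : 'cV[R]_d) : R :=
  dot s (u - z0) - enorm (u - z0) ^+ 2 / 2.

(* v k is the prox point of sigma k, and x k solves the model subproblem at
   v k inexactly; both happen before the stopping test. *)
Definition viji_inner (k : nat) : Prop :=
  [/\ Z (v k),
      forall u, Z u -> viji_objective (sigma k) u <= viji_objective (sigma k) (v k),
      Z (x k)
    & sup [set dot (viji_model (v k) (J k) (x k)) (x k - z) | z in Z]
        <= L1 / 2 * enorm (x k - v k) ^+ 3 + delta * enorm (x k - v k) ^+ 2].

Definition viji_bracket (k : nat) : R :=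
  L1 / 2 * enorm (x k - v k) + rho k.

(* Can only hold if viji_bracket k is nonzero. *)
Definition viji_dual (k : nat) : Prop :=
  [/\ 0 < lambda k, 1 / 32 <= lambda k * viji_bracket k <= 1 / 22
    & sigma k.+1 = sigma k - lambda k *: F (x k)].

Definition viji_average (T : nat) : 'cV[R]_d :=
  (\sum_(k < T) lambda k)^-1 *: \sum_(k < T) lambda k *: x k.

(* viji_output T N zout: run for T iterations, the scheme enters the outer
   iterations 0, ..., N - 1 and outputs zout.  Either all T iterations are
   completed, or the scheme stops at the first zero bracket. *)
Inductive viji_output (T : nat) : nat -> 'cV[R]_d -> Prop :=
| viji_complete :
    Z z0 -> sigma 0%N = 0 ->
    (forall k, (k < T)%N -> viji_inner k /\ viji_dual k) ->
    viji_output T T (viji_average T)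
| viji_stop k :
    Z z0 -> sigma 0%N = 0 -> (k < T)%N ->
    (forall j, (j < k)%N -> viji_inner j /\ viji_dual j) ->
    viji_inner k -> viji_bracket k = 0 ->
    viji_output T k.+1 (x k).

End Scheme.

(* Main.v *)
Require Import Defs.
From HB Require Import structures.
From mathcomp Require Import all_boot all_order all_algebra.
From mathcomp Require Import all_classical all_reals all_analysis.
From mathcomp Require Import ring lra.

Set Implicit Arguments.
Unset Strict Implicit.

Import Order.TTheory GRing.Theory Num.Theory.
Import numFieldNormedType.Exports.

Local Open Scope classical_set_scope.
Local Open Scope ring_scope.

(** The scheme is a dual extragradient method, and the rate comes from an
energy argument.

Write r_k for the length of x_k - v_k and g_k = (L/2) r_k + delta for the
bracket of the dual step.  The Jacobian surrogate is within delta of the true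
Jacobian and the Jacobian is L-Lipschitz, so F(x_k) differs from its linear
model at v_k by at most g_k r_k ([jacobian_taylor]).  The regularizer of
the model operator is 10 g_k (x_k - v_k), which dominates this error: for every
u in Z,
  <F(x_k), x_k - u> <= g_k (r_k |x_k - u| - 10 <x_k - v_k, x_k - u> + r_k^2)
([viji_model_gap]).  Since lambda_k g_k lies in [1/32, 1/22], multiplying by
lambda_k and completing a square gives ([viji_descent])
  lambda_k <F(x_k), x_k - u> - |u - v_k|^2 / 2 <= - r_k^2 / 8.

The term |u - v_k|^2 / 2 is what the strong concavity of the prox objective
at its maximizer v_k provides ([prox_strong_concavity]), so the
inequalities telescope to ([viji_regret])
  sum_k lambda_k <F(x_k), x_k - u> + (1/8) sum_k r_k^2 <= |u - z0|^2 / 2.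

By monotonicity the first sum is at least Lambda <F(u), zT - u>, where
Lambda = sum_k lambda_k.  If <F(u), zT - u> is nonpositive nothing is to be
proved for u.  Otherwise the first sum is nonnegative, whence
sum_k r_k^2 <= 4 D^2 and, by Cauchy-Schwarz,
sum_k g_k <= L D sqrt T + delta T.  Again by Cauchy-Schwarz, the lower bounds
lambda_k g_k >= 1/32 give T^2 <= 32 Lambda (sum_k g_k)
([viji_weights]).  Hence
  <F(u), zT - u> <= D^2 / (2 Lambda) <= 16 D^2 (L D sqrt T + delta T) / T^2,
which is the claimed rate without the factor sqrt 2.  Splitting on the sign of
<F(u), zT - u> for each u avoids the existence of a solution of the variational
inequality.

If the scheme stops early, then r_k = 0 = delta, the model inequality above
becomes <F(x_k), x_k - u> <= 0 for all u in Z, and monotonicity makes the gap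
nonpositive ([viji_stop_gap]).

For the secant surrogate, both DF - DF1 on Z and the projected matrix have
operator norm at most beta, so their difference has norm at most 2 beta. *)

(** * Euclidean and operator norms *)

Section EuclideanGeometry.
Context {R : realType}.

Section Dot.
Context {d : nat}.
Implicit Types u v w : 'cV[R]_d.

Lemma dotC u v : dot u v = dot v u.
Proof. by apply: eq_bigr => i _; rewrite mulrC. Qed.

Lemma dotDl u v w : dot (u + v) w = dot u w + dot v w.
Proof.
by rewrite /dot -big_split; apply: eq_bigr => i _; rewrite mxE mulrDl.
Qed.

Lemma dotZl a u v : dot (a *: u) v = a * dot u v.
Proof. by rewrite /dot mulr_sumr; apply: eq_bigr => i _; rewrite mxE mulrA. Qed.

Lemma dotNl u v : dot (- u) v = - dot u v.
Proof. by rewrite -scaleN1r dotZl mulN1r. Qed.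

Lemma dotDr u v w : dot w (u + v) = dot w u + dot w v.
Proof. by rewrite dotC dotDl !(dotC w). Qed.

Lemma dotZr a u v : dot v (a *: u) = a * dot v u.
Proof. by rewrite dotC dotZl dotC. Qed.

Lemma dotNr u v : dot v (- u) = - dot v u.
Proof. by rewrite dotC dotNl dotC. Qed.

Lemma dot0r u : dot u 0 = 0.
Proof. by rewrite -(scale0r 0) dotZr mul0r. Qed.

Lemma dot_sumr I (s : seq I) (f : I -> 'cV[R]_d) u :
  dot u (\sum_(i <- s) f i) = \sum_(i <- s) dot u (f i).
Proof.
by elim/big_rec2: _ => [|i a b _ IH]; rewrite ?dot0r// dotDr IH.
Qed.

Lemma dot_ge0 u : 0 <= dot u u.
Proof. by apply: sumr_ge0 => i _; rewrite -expr2 sqr_ge0. Qed.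

Lemma enorm_ge0 u : 0 <= enorm u.
Proof. exact: sqrtr_ge0. Qed.

Lemma enorm_sq u : enorm u ^+ 2 = dot u u.
Proof. by rewrite sqr_sqrtr ?dot_ge0. Qed.

Lemma enorm0 : enorm (0 : 'cV[R]_d) = 0.
Proof. by rewrite /enorm dot0r sqrtr0. Qed.

Lemma enorm0_eq0 u : enorm u = 0 -> u = 0.
Proof.
move=> u0; have := enorm_sq u; rewrite u0 expr0n /= => /esym/eqP.
rewrite psumr_eq0 => [/allP uu|i _]; last by rewrite -expr2 sqr_ge0.
apply/matrixP => i j; rewrite ord1 mxE.
by have /eqP := uu i (mem_index_enum i); move/eqP; rewrite mulf_eq0 orbb => /eqP.
Qed.

Lemma enormZ a u : enorm (a *: u) = `|a| * enorm u.
Proof.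
by rewrite /enorm dotZl dotZr mulrA -expr2 sqrtrM ?sqr_ge0// sqrtr_sqr.
Qed.

Lemma enormN u : enorm (- u) = enorm u.
Proof. by rewrite -scaleN1r enormZ normrN1 mul1r. Qed.

(** Cauchy-Schwarz, from expanding the square of the vector
[dot v v *: u - dot u v *: v]. *)
Lemma dot_sq_le u v : dot u v ^+ 2 <= dot u u * dot v v.
Proof.
have [v0|v0] := eqVneq (dot v v) 0.
  have : enorm v = 0 by rewrite /enorm v0 sqrtr0.
  by move/enorm0_eq0 => ->; rewrite !dot0r expr0n mulr0.
have vgt0 : 0 < dot v v by rewrite lt_neqAle eq_sym v0 dot_ge0.
have := dot_ge0 (dot v v *: u - dot u v *: v).
rewrite !(dotDl, dotDr, dotNl, dotNr, dotZl, dotZr) (dotC v u).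
move=> h; rewrite -subr_ge0 -(pmulr_rge0 _ vgt0).
by apply: le_trans h _; rewrite le_eqVlt; apply/orP; left; apply/eqP; ring.
Qed.

Lemma dot_le_enorm u v : dot u v <= enorm u * enorm v.
Proof.
apply: le_trans (ler_norm _) _.
rewrite -ler_sqr ?nnegrE ?mulr_ge0 ?enorm_ge0//.
by rewrite real_normK ?num_real// exprMn !enorm_sq dot_sq_le.
Qed.

Lemma enormD u v : enorm (u + v) <= enorm u + enorm v.
Proof.
rewrite -ler_sqr ?nnegrE ?addr_ge0 ?enorm_ge0//.
rewrite enorm_sq !(dotDl, dotDr) (dotC v u) sqrrD !enorm_sq.
have := dot_le_enorm u v; lra.
Qed.

Lemma enormB u v : enorm (u - v) <= enorm u + enorm v.
Proof. by rewrite -(enormN v) enormD. Qed.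

Lemma enorm_distC u v : enorm (u - v) = enorm (v - u).
Proof. by rewrite -enormN opprB. Qed.

Lemma enorm_sum I (s : seq I) (f : I -> 'cV[R]_d) :
  enorm (\sum_(i <- s) f i) <= \sum_(i <- s) enorm (f i).
Proof.
elim/big_rec2: _ => [|i a b _ IH]; first by rewrite enorm0.
by apply: le_trans (enormD _ _) _; rewrite lerD2l.
Qed.

End Dot.

Lemma sum_mul_sq_le n (f g : 'I_n -> R) :
  (\sum_i f i * g i) ^+ 2 <= (\sum_i f i ^+ 2) * (\sum_i g i ^+ 2).
Proof.
have := dot_sq_le (\col_i f i) (\col_i g i); rewrite /dot.
under eq_bigr => i _ do rewrite !mxE.
under [X in _ <= X * _]eq_bigr => i _ do rewrite !mxE -expr2.
by under [X in _ <= _ * X]eq_bigr => i _ do rewrite !mxE -expr2.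
Qed.

Lemma sum_sq_le n (f : 'I_n -> R) :
  (\sum_i f i) ^+ 2 <= n%:R * \sum_i f i ^+ 2.
Proof.
have := sum_mul_sq_le f (fun=> 1).
under eq_bigr => i _ do rewrite mulr1.
by rewrite expr1n sumr_const card_ord mulrC.
Qed.

Section OperatorNorm.
Context {m n : nat}.
Implicit Types A B : 'M[R]_(m, n).

Lemma entry_le_norm A i j : `|A i j| <= `|A|.
Proof.
rewrite [leRHS]/Num.Def.normr/= mx_normrE.
exact: (le_bigmax _ (fun ij : 'I_m * 'I_n => `|A ij.1 ij.2|) (i, j)).
Qed.

Lemma enorm_mulmx_le A u : enorm (A *m u) <= frobenius A * enorm u.
Proof.
rewrite -ler_sqr ?nnegrE ?mulr_ge0 ?enorm_ge0 ?sqrtr_ge0//.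
rewrite exprMn !enorm_sq sqr_sqrtr; last first.
  by apply: sumr_ge0 => i _; apply: sumr_ge0 => j _; rewrite sqr_ge0.
rewrite mulr_suml /dot; apply: ler_sum => i _; rewrite -expr2 mxE.
by under [X in _ <= _ * X]eq_bigr => j _ do rewrite -expr2; exact: sum_mul_sq_le.
Qed.

Lemma opnorm_has_ubound A :
  has_ubound [set enorm (A *m u) | u in [set u : 'cV[R]_n | enorm u <= 1]].
Proof.
exists (frobenius A) => _ [u /= u1 <-].
apply: le_trans (enorm_mulmx_le A u) _.
by rewrite ler_piMr ?sqrtr_ge0.
Qed.

Lemma enorm_mulmx A u : enorm (A *m u) <= opnorm A * enorm u.
Proof.
have [u0|u0] := eqVneq (enorm u) 0.
  by rewrite u0 mulr0 (enorm0_eq0 u0) mulmx0 enorm0.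
have ugt0 : 0 < enorm u by rewrite lt_neqAle eq_sym u0 enorm_ge0.
rewrite -ler_pdivrMr// mulrC -[X in X * _]ger0_norm ?invr_ge0 ?enorm_ge0//.
rewrite -enormZ scalemxAr; apply: ub_le_sup; first exact: opnorm_has_ubound.
exists ((enorm u)^-1 *: u) => //=.
by rewrite enormZ ger0_norm ?invr_ge0 ?enorm_ge0// mulVf.
Qed.

Lemma opnorm_le A c : 0 <= c ->
  (forall u, enorm (A *m u) <= c * enorm u) -> opnorm A <= c.
Proof.
move=> c0 Ac; apply: ge_sup.
  by exists (enorm (A *m 0)); exists 0 => //=; rewrite enorm0 ler01.
by move=> _ [u /= u1 <-]; apply: le_trans (Ac u) _; rewrite ler_piMr.
Qed.

Lemma opnorm_ge0 A : 0 <= opnorm A.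
Proof.
have := ub_le_sup (opnorm_has_ubound A); apply.
by exists 0; rewrite /= ?mulmx0 ?enorm0 ?ler01.
Qed.

Lemma opnormD A B : opnorm (A + B) <= opnorm A + opnorm B.
Proof.
apply: opnorm_le => [|u]; first by rewrite addr_ge0 ?opnorm_ge0.
rewrite mulmxDl mulrDl; apply: le_trans (enormD _ _) _.
by apply: lerD; exact: enorm_mulmx.
Qed.

Lemma opnormB A B : opnorm (A - B) <= opnorm A + opnorm B.
Proof.
apply: opnorm_le => [|u]; first by rewrite addr_ge0 ?opnorm_ge0.
rewrite mulmxBl mulrDl; apply: le_trans (enormB _ _) _.
by apply: lerD; exact: enorm_mulmx.
Qed.

(** Compactness and continuity speak of the norm [`|A|], the maximum of the
entries; this comparison transfers the bounds that they give to the Euclidean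
norms. *)
Lemma frobenius_le_norm A : frobenius A <= Num.sqrt (m * n)%:R * `|A|.
Proof.
rewrite -[X in _ * X]ger0_norm// -sqrtr_sqr -sqrtrM// ler_wsqrtr//.
apply: (@le_trans _ _ (\sum_(i < m) \sum_(j < n) `|A| ^+ 2)).
  apply: ler_sum => i _; apply: ler_sum => j _.
  by rewrite -[leLHS]real_normK ?num_real// lerXn2r ?nnegrE ?entry_le_norm.
by rewrite sumr_const sumr_const !card_ord -mulrnA mulr_natl mulnC.
Qed.

Lemma opnorm_le_norm A : opnorm A <= Num.sqrt (m * n)%:R * `|A|.
Proof.
apply: opnorm_le => [|u]; first by rewrite mulr_ge0 ?sqrtr_ge0.
apply: le_trans (enorm_mulmx_le A u) _.
by rewrite ler_wpM2r ?enorm_ge0 ?frobenius_le_norm.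
Qed.

End OperatorNorm.

Lemma enorm_le_norm d (u : 'cV[R]_d) : enorm u <= Num.sqrt d%:R * `|u|.
Proof.
have := frobenius_le_norm u; rewrite muln1; apply: le_trans.
by apply/ler_wsqrtr/ler_sum => i _; rewrite big_ord1 expr2.
Qed.

End EuclideanGeometry.

(** * Suprema over a compact set *)

(* A bound on the real-valued [sup] of a set says something about its elements
   only if the set is bounded; the lemmas of this part provide the bounds. *)
Section CompactSuprema.
Context {R : realType} {d : nat}.
Implicit Types (Z : set 'cV[R]_d) (u p z : 'cV[R]_d).

Lemma compact_enorm_bounded Z : compact Z ->
  exists M, 0 <= M /\ forall z, Z z -> enorm z <= M.
Proof.
move=> /compact_bounded[M0 [_ ZM0]]; set M := `|M0| + 1.
have ZM z : Z z -> `|z| <= M.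
  by move=> Zz; apply: ZM0 => //; rewrite ltr_pwDr// ler_norm.
exists (Num.sqrt d%:R * M); split.
  by rewrite mulr_ge0 ?sqrtr_ge0 ?addr_ge0 ?normr_ge0 ?ler01.
move=> z Zz; apply: le_trans (enorm_le_norm z) _.
by rewrite ler_wpM2l ?sqrtr_ge0 ?ZM.
Qed.

Lemma compact_dot_has_ubound Z u p : compact Z ->
  has_ubound [set dot u (p - z) | z in Z].
Proof.
move=> /compact_enorm_bounded[M [M0 ZM]].
exists (enorm u * (enorm p + M)) => _ [z Zz <-].
apply: le_trans (dot_le_enorm _ _) _; rewrite ler_wpM2l ?enorm_ge0//.
by apply: le_trans (enormB _ _) _; rewrite lerD2l ZM.
Qed.

Lemma enorm_le_diameter Z u p : compact Z -> Z u -> Z p ->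
  enorm (u - p) <= diameter Z.
Proof.
move=> /compact_enorm_bounded[M [M0 ZM]] Zu Zp.
apply: ub_le_sup; last by exists (u, p).
exists (M + M) => _ [[a b] [/= Za Zb] <-].
by apply: le_trans (enormB _ _) _; rewrite lerD ?ZM.
Qed.

Lemma opnorm_compact_bounded Z (DF : 'cV[R]_d -> 'M[R]_d) :
  compact Z -> {within Z, continuous DF} ->
  exists M, forall z, Z z -> opnorm (DF z) <= M.
Proof.
move=> cZ cDF; have /compact_bounded[M0 [_ ZM0]] := continuous_compact cDF cZ.
exists (Num.sqrt (d * d)%:R * (M0 + 1)) => z Zz.
apply: le_trans (opnorm_le_norm _) _; rewrite ler_wpM2l ?sqrtr_ge0//.
by apply: ZM0; [rewrite ltrDl|exists z].
Qed.

(** [DF] varies by at most [L * diameter Z] over [Z], and [DF1] is bounded on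
[Z] by compactness. *)
Lemma dissimilarity_has_ubound Z (DF DF1 : 'cV[R]_d -> 'M[R]_d) L :
  compact Z -> Z !=set0 -> 0 < L -> jacobian_lipschitz_on Z DF L ->
  {within Z, continuous DF1} ->
  has_ubound [set opnorm (DF z - DF1 z) | z in Z].
Proof.
move=> cZ [p Zp] L0 DFL /(opnorm_compact_bounded cZ)[M ZM].
exists (L * diameter Z + opnorm (DF p) + M) => _ [z Zz <-].
apply: le_trans (opnormB _ _) _; apply: lerD; last exact: ZM.
rewrite -{1}[DF z](subrK (DF p)); apply: le_trans (opnormD _ _) _.
rewrite lerD2r; apply: le_trans (DFL _ _ Zz Zp) _.
by rewrite ler_wpM2l ?(ltW L0)// enorm_le_diameter.
Qed.

Lemma dissimilarity_ge0 Z (DF DF1 : 'cV[R]_d -> 'M[R]_d) :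
  0 <= dissimilarity Z DF DF1.
Proof.
have [[[y Ey] ubE]|/sup_out E0] :=
  pselect (has_sup [set opnorm (DF z - DF1 z) | z in Z]); last first.
  by rewrite /dissimilarity E0.
by apply: le_trans (ub_le_sup ubE Ey); case: Ey => z _ <-; exact: opnorm_ge0.
Qed.

End CompactSuprema.

(** * First-order expansion and the prox step *)

Section Taylor.
Context {R : realType}.

(** A mean value inequality for straddled difference quotients, by continuous
induction: the points [t] with [f t <= f 0 + e * t] contain their supremum, and
the straddle condition at the supremum, if it is not 1, yields a larger such
point. *)
Lemma straddle_nonincreasing (f : R -> R) :
  (forall t e, 0 <= t <= 1 -> 0 < e -> exists2 eta, 0 < eta &
    forall s s', 0 <= s -> s <= t -> t <= s' -> s' <= 1 -> s' - s < eta ->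
      f s' - f s <= e * (s' - s)) ->
  f 1 <= f 0.
Proof.
move=> fS; apply/ler_addgt0Pr => e e0.
pose S := [set t | 0 <= t <= 1 /\ f t <= f 0 + e * t].
have S0 : S 0 by split; rewrite ?lexx ?ler01// mulr0 addr0.
have supS : has_sup S by split; [exists 0|exists 1 => t [/andP[]]].
set c := sup S.
have c01 : 0 <= c <= 1.
  apply/andP; split; first exact: (ub_le_sup supS.2 S0).
  by apply: ge_sup => [|t [/andP[]]//]; exists 0.
have /andP[c0 c1] := c01.
have [eta eta0 fc] := fS c e c01 e0.
have Sc : f c <= f 0 + e * c.
  have [t St tc] := sup_adherent eta0 supS; have tlec := ub_le_sup supS.2 St.
  case: St => /andP[t0 t1] ft.
  have := fc t c t0 tlec (lexx c) c1; rewrite -/c in tc tlec *.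
  by move=> /(_ ltac:(lra)); lra.
have [c_eq1|c_neq1] := eqVneq c 1; first by rewrite c_eq1 mulr1 in Sc.
have clt1 : c < 1 by rewrite lt_neqAle c_neq1.
pose s := Num.min 1 (c + eta / 2).
have cs : c < s by rewrite lt_min clt1 ltrDl divr_gt0.
have s1 : s <= 1 by rewrite ge_min lexx.
have seta : s <= c + eta / 2 by rewrite ge_min lexx orbT.
have Ss : S s.
  split; first by apply/andP; split => //; lra.
  have := fc c s c0 (lexx c) (ltW cs) s1 ltac:(lra); lra.
by have := ub_le_sup supS.2 Ss; rewrite -/c leNgt cs.
Qed.

Context {d : nat}.
Implicit Types (Z : set 'cV[R]_d) (u v x : 'cV[R]_d).

Lemma convex_segment Z v x t :
  convex_set (Z : set (convex_lmodType 'cV[R]_d)) -> Z v -> Z x ->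
  0 <= t <= 1 -> Z (v + t *: (x - v)).
Proof.
move=> cZ Zv Zx /andP[t0 t1].
have := cZ x v (Itv01 t0 t1) (mem_set Zx) (mem_set Zv); rewrite inE.
congr (Z _); rewrite /conv /= /unstable.onem scalerBl scale1r scalerBr.
by rewrite addrCA.
Qed.

Lemma C1_on_mixture n (w : 'I_n -> R) Z Fi DFi :
  (forall i, 0 <= w i) -> \sum_i w i = 1 ->
  (forall i, C1_on Z (Fi i) (DFi i)) ->
  forall z, Z z -> forall e : R, 0 < e ->
    \forall y \near within Z (nbhs z),
      enorm (mixture w Fi y - mixture w Fi z - mixture w DFi z *m (y - z))
        <= e * enorm (y - z).
Proof.
move=> w0 w1 C1 z Zz e e0.
have Fnear i := (C1 i).1 z Zz e e0.
apply: (@filterS _ (within Z (nbhs z)) _ _ _ _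
  (filter_forall (within_filter Z (nbhs_filter z)) Fnear)) => y Fy.
rewrite /mixture -sumrB mulmx_suml -sumrB.
apply: le_trans (enorm_sum _ _) _.
rewrite -[leRHS]mul1r -w1 mulr_suml; apply: ler_sum => i _.
rewrite -scalemxAl -!scalerBr enormZ ger0_norm//.
by rewrite ler_wpM2l.
Qed.

(** The second-order Taylor bound.  The expansion of [F] is only known relative
to [Z], so derivatives along the segment from [v] to [x] are replaced by
increments: [phi t] is the norm of the remainder at [v + t *: h] minus its
claimed bound, and [straddle_nonincreasing] shows [phi 1 <= phi 0 = 0]. *)
Lemma jacobian_taylor Z F DF L v x :
  convex_set (Z : set (convex_lmodType 'cV[R]_d)) ->
  (forall z, Z z -> forall e : R, 0 < e ->
    \forall y \near within Z (nbhs z),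
      enorm (F y - F z - DF z *m (y - z)) <= e * enorm (y - z)) ->
  0 <= L -> jacobian_lipschitz_on Z DF L -> Z v -> Z x ->
  enorm (F x - F v - DF v *m (x - v)) <= L / 2 * enorm (x - v) ^+ 2.
Proof.
move=> cZ diffF L0 DFL Zv Zx.
set h := x - v; set r := enorm h; have r0 : 0 <= r := enorm_ge0 h.
pose p t := v + t *: h.
have Zp t : 0 <= t <= 1 -> Z (p t) by exact: convex_segment.
pose f t := F (p t) - F v - t *: (DF v *m h).
pose phi t := enorm (f t) - L / 2 * r ^+ 2 * t ^+ 2.
suff : phi 1 <= phi 0.
  rewrite /phi /f /p !(scale0r, scale1r, addr0) subrr subr0 enorm0.
  rewrite expr0n expr1n mulr0 mulr1 subr0 subr_le0.
  by rewrite [v + h]addrC subrK.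
apply: straddle_nonincreasing => t e t01 e0.
have /andP[t0 t1] := t01.
pose e1 := e / 2 / (r + 1).
have e10 : 0 < e1 by rewrite !divr_gt0// ltr_wpDl.
have e1r : e1 * r <= e / 2.
  rewrite /e1 mulrAC ler_pdivrMr ?ltr_wpDl//.
  by rewrite ler_wpM2l ?divr_ge0 ?(ltW e0)// lerDl.
have /nbhs_normP[eta1 /= eta10 near_t] : \forall y \near (p t), Z y ->
    enorm (F y - F (p t) - DF (p t) *m (y - p t)) <= e1 * enorm (y - p t).
  exact: diffF (Zp _ t01) _ e10.
have expand s : 0 <= s <= 1 -> `|s - t| * (`|h| + 1) < eta1 ->
    enorm (F (p s) - F (p t) - (s - t) *: (DF (p t) *m h)) <= e1 * (`|s - t| * r).
  move=> s01 st.
  have pE : p s - p t = (s - t) *: h.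
    by rewrite /p opprD addrACA subrr add0r -scalerBl.
  rewrite -/r -enormZ scalemxAr -pE; apply: near_t; last exact: Zp.
  rewrite /ball_ /= distrC pE normrZ; apply: le_lt_trans st.
  by rewrite ler_wpM2l// lerDl.
pose eta := Num.min (eta1 / (`|h| + 1)) (e / (L * r ^+ 2 + 1)).
have h1 : 0 < `|h| + 1 by rewrite ltr_wpDl.
have Lr0 : 0 <= L * r ^+ 2 by rewrite mulr_ge0// sqr_ge0.
have Lr1 : 0 < L * r ^+ 2 + 1 by rewrite ltr_wpDl.
exists eta => [|s s' s0 st ts' s'1]; first by rewrite lt_min !divr_gt0.
rewrite lt_min !ltr_pdivlMr// => /andP[ss1 ss2].
have Es : enorm (F (p s) - F (p t) - (s - t) *: (DF (p t) *m h))
    <= e1 * ((t - s) * r).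
  have -> : t - s = `|s - t| by rewrite distrC ger0_norm ?subr_ge0.
  apply: expand; first by rewrite s0 /=; lra.
  rewrite distrC ger0_norm ?subr_ge0//; apply: le_lt_trans ss1.
  by rewrite ler_wpM2r ?(ltW h1)//; lra.
have Es' : enorm (F (p s') - F (p t) - (s' - t) *: (DF (p t) *m h))
    <= e1 * ((s' - t) * r).
  have -> : e1 * ((s' - t) * r) = e1 * (`|s' - t| * r).
    by rewrite ger0_norm ?subr_ge0.
  apply: expand; first by rewrite s'1 andbT; lra.
  rewrite ger0_norm ?subr_ge0//; apply: le_lt_trans ss1.
  by rewrite ler_wpM2r ?(ltW h1)//; lra.
have Dt : enorm ((DF (p t) - DF v) *m h) <= L * t * r ^+ 2.
  apply: le_trans (enorm_mulmx _ _) _; rewrite expr2 mulrA ler_wpM2r//.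
  apply: le_trans (DFL _ _ (Zp _ t01) Zv) _.
  by rewrite /p addrAC subrr add0r enormZ ger0_norm// mulrA.
have fE : f s' - f s = (F (p s') - F (p t) - (s' - t) *: (DF (p t) *m h))
    - (F (p s) - F (p t) - (s - t) *: (DF (p t) *m h))
    + (s' - s) *: ((DF (p t) - DF v) *m h).
  rewrite /f mulmxBl; apply/matrixP => i j; rewrite !mxE; ring.
have fss' : enorm (f s') - enorm (f s) <= e / 2 * (s' - s)
    + (s' - s) * (L * t * r ^+ 2).
  rewrite lerBlDr -{1}(subrK (f s) (f s')); apply: le_trans (enormD _ _) _.
  rewrite lerD2r fE; apply: le_trans (enormD _ _) _; apply: lerD.
    apply: le_trans (enormB _ _) (le_trans (lerD Es' Es) _).
    have -> : e1 * ((s' - t) * r) + e1 * ((t - s) * r) = e1 * r * (s' - s) by ring.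
    by rewrite ler_wpM2r// subr_ge0; lra.
  rewrite enormZ ger0_norm ?subr_ge0; last by lra.
  by rewrite ler_wpM2l// subr_ge0; lra.
(* The bound (L/2) r^2 t^2 grows by L r^2 (s' - s) times the midpoint of
   [s, s'], while the remainder grows by L r^2 (s' - s) t; the difference is of
   second order in s' - s, hence the second term in the choice of [eta]. *)
have ss0 : 0 <= s' - s by lra.
have key : L * r ^+ 2 * (t - (s' + s) / 2) <= e / 2.
  apply: (@le_trans _ _ (L * r ^+ 2 * ((s' - s) / 2))).
    by rewrite ler_wpM2l//; lra.
  by move: ss2; rewrite mulrDr mulr1; lra.
have := ler_wpM2r ss0 key; rewrite /phi; move: fss'; nra.
Qed.

(** The prox objective is a concave quadratic with Hessian minus the identity,
and its derivative [c] at the maximizer [v] towards [u] is nonpositive. *)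
Lemma prox_strong_concavity Z (s u v z0 : 'cV[R]_d) :
  convex_set (Z : set (convex_lmodType 'cV[R]_d)) -> Z v -> Z u ->
  (forall y, Z y -> viji_objective z0 s y <= viji_objective z0 s v) ->
  viji_objective z0 s u <= viji_objective z0 s v - enorm (u - v) ^+ 2 / 2.
Proof.
move=> cZ Zv Zu vmax; set h := u - v.
pose c := dot (s - (v - z0)) h.
have expand t : viji_objective z0 s (v + t *: h)
    = viji_objective z0 s v + t * c - t ^+ 2 * enorm h ^+ 2 / 2.
  rewrite /viji_objective /c !enorm_sq -addrA [t *: h - z0]addrC addrA.
  rewrite !(dotDl, dotDr, dotNl, dotNr, dotZl, dotZr).
  by rewrite (dotC u v) (dotC z0 u) (dotC z0 v); field.
have small t : 0 < t <= 1 -> c <= t * (enorm h ^+ 2 / 2).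
  move=> /andP[t0 t1]; have := vmax _ (convex_segment cZ Zv Zu (t := t) _).
  rewrite (ltW t0) t1 => /(_ isT); rewrite -/h expand => H.
  by rewrite -(ler_pM2l t0); move: H; lra.
have c0 : c <= 0.
  rewrite leNgt; apply/negP => cgt0.
  set q := enorm h ^+ 2 / 2 in small.
  have q0 : 0 <= q by rewrite divr_ge0// sqr_ge0.
  have cq : 0 < c + q by rewrite ltr_wpDr.
  (* If c > 0, the step t = c / (c + q) is small enough that t q < c. *)
  have := small (c / (c + q)).
  rewrite divr_gt0//= ler_pdivrMr// mul1r lerDl q0 => /(_ isT).
  by rewrite mulrAC ler_pdivlMr//; nra.
have := expand 1; rewrite scale1r mul1r expr1n mul1r /h [v + _]addrC subrK => ->.
lra.
Qed.

End Taylor.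

(** * Convergence of the scheme *)

Section VijiConvergence.
Context {R : realType} {d : nat}.
Variables (Z : set 'cV[R]_d) (F : 'cV[R]_d -> 'cV[R]_d).
Variables (DF : 'cV[R]_d -> 'M[R]_d) (L delta : R).
Hypotheses (compactZ : compact Z) (Z0 : Z !=set0).
Hypothesis convexZ : convex_set (Z : set (convex_lmodType 'cV[R]_d)).
Hypothesis monoF : monotone_on Z F.
Hypotheses (L_gt0 : 0 < L) (delta_ge0 : 0 <= delta).
Hypothesis taylorF : forall v x, Z v -> Z x ->
  enorm (F x - F v - DF v *m (x - v)) <= L / 2 * enorm (x - v) ^+ 2.

(** The factor in front is the bracket of the dual step: both the error of the
linear model and the inexactness of the subproblem are multiples of it, and so
is the regularizer [(10 * delta + 5 * L * r) *: (x - v)] of the model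
operator. *)
Lemma viji_model_gap J v x u : Z v -> Z x -> Z u ->
  opnorm (DF v - J) <= delta ->
  sup [set dot (viji_model F L delta v J x) (x - z) | z in Z]
    <= L / 2 * enorm (x - v) ^+ 3 + delta * enorm (x - v) ^+ 2 ->
  dot (F x) (x - u) <= (L / 2 * enorm (x - v) + delta) *
    (enorm (x - v) * enorm (x - u) - 10 * dot (x - v) (x - u)
     + enorm (x - v) ^+ 2).
Proof.
move=> Zv Zx Zu HJ; set r := enorm (x - v) => xinex.
have r0 : 0 <= r := enorm_ge0 _.
pose E := F x - F v - DF v *m (x - v) + (DF v - J) *m (x - v).
have EE : enorm E <= L / 2 * r ^+ 2 + delta * r.
  apply: le_trans (enormD _ _) _; apply: lerD; first exact: taylorF.
  apply: le_trans (enorm_mulmx _ _) _.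
  by rewrite ler_wpM2r.
have Fdecomp : F x = viji_model F L delta v J x + E
    - (10 * delta + 5 * L * r) *: (x - v).
  rewrite /viji_model /E mulmxBl -/r; apply/matrixP => i j; rewrite !mxE; ring.
have inex : dot (viji_model F L delta v J x) (x - u)
    <= L / 2 * r ^+ 3 + delta * r ^+ 2.
  apply: le_trans xinex; apply: ub_le_sup; last by exists u.
  exact: compact_dot_has_ubound.
have dE : dot E (x - u) <= (L / 2 * r ^+ 2 + delta * r) * enorm (x - u).
  by apply: le_trans (dot_le_enorm _ _) _; rewrite ler_wpM2r ?enorm_ge0.
rewrite {1}Fdecomp 2!dotDl dotNl dotZl.
apply: le_trans (lerB (lerD inex dE) (lexx _)) _.
by rewrite le_eqVlt; apply/orP; left; apply/eqP; field.
Qed.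

(** With [r] and [p] the lengths of [x - v] and [u - v], and [tau] the product
of [lambda] and the bracket, [viji_model_gap] becomes
[tau * (11 r p - 8 r^2)]; the bounds on [tau] turn it into
[r p / 2 - r^2 / 4], and [r p / 2 - p^2 / 2 <= r^2 / 8]. *)
Lemma viji_descent J v x u lambda : Z v -> Z x -> Z u ->
  opnorm (DF v - J) <= delta ->
  sup [set dot (viji_model F L delta v J x) (x - z) | z in Z]
    <= L / 2 * enorm (x - v) ^+ 3 + delta * enorm (x - v) ^+ 2 ->
  0 < lambda ->
  1 / 32 <= lambda * (L / 2 * enorm (x - v) + delta) <= 1 / 22 ->
  lambda * dot (F x) (x - u) - enorm (u - v) ^+ 2 / 2
    <= - (8^-1 * enorm (x - v) ^+ 2).
Proof.
move=> Zv Zx Zu HJ xinex lam0 /andP[tau1 tau2].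
have := viji_model_gap Zv Zx Zu HJ xinex; rewrite -(ler_pM2l lam0) mulrA.
have xuE : x - u = (x - v) + (v - u) by rewrite addrA subrK.
have dotE : dot (x - v) (x - u) = enorm (x - v) ^+ 2 + dot (x - v) (v - u).
  by rewrite xuE dotDr enorm_sq.
have dot_lower : - (enorm (x - v) * enorm (u - v)) <= dot (x - v) (v - u).
  rewrite lerNl; apply: le_trans (dot_le_enorm _ _).
  by rewrite -(opprB u v) dotNr opprK.
have tri : enorm (x - u) <= enorm (x - v) + enorm (u - v).
  by rewrite xuE (enorm_distC u); exact: enormD.
rewrite dotE; move: dot_lower tri tau1 tau2.
set q := dot (x - v) (v - u); set tau := lambda * _.
move: (enorm_ge0 (x - v)) (enorm_ge0 (u - v)) (enorm_ge0 (x - u)).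
set r := enorm (x - v); set p := enorm (u - v); set a := enorm (x - u).
move=> r0 p0 a0 qlo tri tau1 tau2 main.
have tau0 : 0 <= tau by lra.
have bound : tau * (r * a - 10 * (r ^+ 2 + q) + r ^+ 2)
    <= tau * (11 * (r * p) - 8 * r ^+ 2).
  by rewrite ler_wpM2l//; have := ler_wpM2l r0 tri; lra.
have rp : 0 <= r * p by rewrite mulr_ge0.
have cross : tau * (r * p) <= 1 / 22 * (r * p) by rewrite ler_wpM2r.
have quad : 1 / 32 * r ^+ 2 <= tau * r ^+ 2 by rewrite ler_wpM2r ?sqr_ge0.
have := sqr_ge0 (p - r / 2); rewrite sqrrB.
lra.
Qed.

Variables (J : nat -> 'M[R]_d) (z0 : 'cV[R]_d).
Variables (sigma v x : nat -> 'cV[R]_d) (lambda : nat -> R).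

Let inner := viji_inner Z F L delta J z0 sigma v x.
Let dual := viji_dual F L (fun=> delta) sigma v x lambda.

(** The bound is claimed for every [u] in [Z], not only for a next prox point:
at step [T] the induction hypothesis is used at [v T], and strong concavity
together with [viji_descent] pass from [v T] to [u].  In this way the last step
refers to no prox point beyond the last iteration. *)
Lemma viji_potential T u : sigma 0%N = 0 ->
  (forall k, (k < T)%N -> inner k /\ dual k) ->
  (forall k, (k < T)%N -> opnorm (DF (v k) - J k) <= delta) -> Z u ->
  viji_objective z0 (sigma T) u
    + \sum_(k < T) lambda k * dot (F (x k)) (x k - z0)
  <= - (8^-1 * \sum_(k < T) enorm (x k - v k) ^+ 2).
Proof.
move=> sigma0; elim: T u => [|T IH] u run model Zu.
  rewrite !big_ord0 mulr0 oppr0 addr0 /viji_objective sigma0 dotC dot0r sub0r.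
  by rewrite oppr_le0 divr_ge0// sqr_ge0.
have [[Zv vmax Zx xinex] [lam0 tau sigmaS]] := run T (ltnSn T).
have := IH (v T) (fun k kT => run k (ltnW kT)) (fun k kT => model k (ltnW kT)) Zv.
have := prox_strong_concavity convexZ Zv Zu vmax.
have := viji_descent Zv Zx Zu (model T (ltnSn T)) xinex lam0 tau.
rewrite !big_ord_recr /=.
have -> : viji_objective z0 (sigma T.+1) u
    = viji_objective z0 (sigma T) u - lambda T * dot (F (x T)) (u - z0).
  by rewrite /viji_objective sigmaS dotDl dotNl dotZl; ring.
have -> : dot (F (x T)) (x T - u)
    = dot (F (x T)) (x T - z0) - dot (F (x T)) (u - z0).
  by rewrite !(dotDr, dotNr); ring.
rewrite mulrDr; lra.
Qed.

Lemma sigma_sum T y : sigma 0%N = 0 -> (forall k, (k < T)%N -> dual k) ->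
  dot (sigma T) y = - \sum_(k < T) lambda k * dot (F (x k)) y.
Proof.
move=> sigma0; elim: T => [|T IH] run.
  by rewrite big_ord0 oppr0 sigma0 dotC dot0r.
have [_ _ ->] := run T (ltnSn T).
rewrite dotDl dotNl dotZl IH => [|k kT]; last exact/run/ltnW.
by rewrite big_ord_recr /= opprD.
Qed.

Lemma viji_regret T u : sigma 0%N = 0 ->
  (forall k, (k < T)%N -> inner k /\ dual k) ->
  (forall k, (k < T)%N -> opnorm (DF (v k) - J k) <= delta) -> Z u ->
  \sum_(k < T) lambda k * dot (F (x k)) (x k - u)
    + 8^-1 * \sum_(k < T) enorm (x k - v k) ^+ 2
  <= enorm (u - z0) ^+ 2 / 2.
Proof.
move=> sigma0 run model Zu; have := viji_potential sigma0 run model Zu.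
rewrite /viji_objective sigma_sum// => [|k kT]; last by case: (run k kT).
suff -> : \sum_(k < T) lambda k * dot (F (x k)) (x k - u)
    = \sum_(k < T) lambda k * dot (F (x k)) (x k - z0)
      - \sum_(k < T) lambda k * dot (F (x k)) (u - z0) by lra.
rewrite -sumrB; apply: eq_bigr => k _.
by rewrite !(dotDr, dotNr); ring.
Qed.

(** Cauchy-Schwarz for the square roots of the weights and of the brackets,
whose products are at least [Num.sqrt 32^-1]. *)
Lemma viji_weights T : (forall k, (k < T)%N -> dual k) ->
  T%:R ^+ 2 <= 32 * (\sum_(k < T) lambda k)
    * (\sum_(k < T) (L / 2 * enorm (x k - v k) + delta)).
Proof.
move=> run.
have brk k : (k < T)%N -> 0 <= L / 2 * enorm (x k - v k) + delta.
  by move=> _; rewrite addr_ge0// mulr_ge0 ?enorm_ge0// divr_ge0 ?ltW.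
pose f (k : 'I_T) := Num.sqrt (lambda k).
pose g (k : 'I_T) := Num.sqrt (L / 2 * enorm (x k - v k) + delta).
have := sum_mul_sq_le f g.
under [X in _ <= X * _]eq_bigr => k _.
  rewrite sqr_sqrtr; last by case: (run k (ltn_ord k)) => /ltW.
  over.
under [X in _ <= _ * X]eq_bigr => k _ do rewrite sqr_sqrtr ?brk//.
have fg : T%:R / Num.sqrt 32 <= \sum_i f i * g i.
  rewrite mulr_natl -[X in _ *+ X]card_ord -sumr_const; apply: ler_sum => k _.
  have [lam0 /andP[tau _] _] := run k (ltn_ord k).
  rewrite -sqrtrM ?(ltW lam0)// -sqrtrV ?ler0n// ler_wsqrtr//.
  by rewrite -div1r.
have T0 : 0 <= T%:R / Num.sqrt 32 :> R by rewrite divr_ge0 ?sqrtr_ge0.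
have : (T%:R / Num.sqrt 32) ^+ 2 <= (\sum_i f i * g i) ^+ 2.
  by rewrite lerXn2r ?nnegrE// (le_trans T0).
move=> /le_trans/[apply]; rewrite expr_div_n sqr_sqrtr// ler_pdivrMr//.
by rewrite [_ * _ * 32]mulrC mulrA.
Qed.

Lemma viji_complete_gap T : (0 < T)%N -> Z z0 -> sigma 0%N = 0 ->
  (forall k, (k < T)%N -> inner k /\ dual k) ->
  (forall k, (k < T)%N -> opnorm (DF (v k) - J k) <= delta) ->
  gap Z F (viji_average x lambda T)
    <= 16 * diameter Z ^+ 2
       * (L * diameter Z * Num.sqrt T%:R + delta * T%:R) / T%:R ^+ 2.
Proof.
move=> T0 Zz0 sigma0 run model; have [p Zp] := Z0.
set D := diameter Z.
have D0 : 0 <= D := le_trans (enorm_ge0 _) (enorm_le_diameter compactZ Zp Zp).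
have TR : 0 < T%:R :> R by rewrite ltr0n.
have brk k : 0 <= L / 2 * enorm (x k - v k) + delta.
  by rewrite addr_ge0// mulr_ge0 ?enorm_ge0// divr_ge0 ?ltW.
set Lam := \sum_(k < T) lambda k.
set Gam := \sum_(k < T) (L / 2 * enorm (x k - v k) + delta).
have TLG : T%:R ^+ 2 <= 32 * Lam * Gam.
  by apply: viji_weights => k kT; case: (run k kT).
have Gam0 : 0 <= Gam by apply: sumr_ge0 => k _.
have Lam0 : 0 < Lam.
  rewrite ltNge; apply/negP => Lam_le0.
  have : 32 * Lam * Gam <= 0 by rewrite mulr_le0_ge0// mulr_ge0_le0.
  by move=> /(le_trans TLG); rewrite leNgt exprn_gt0.
have S0 : 0 <= L * D * Num.sqrt T%:R + delta * T%:R.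
  by rewrite addr_ge0// ?mulr_ge0 ?sqrtr_ge0// ltW.
apply: ge_sup => [|_ [u Zu <-]].
  by exists (dot (F p) (viji_average x lambda T - p)); exists p.
set gu := dot (F u) _.
have lam_ge0 (k : 'I_T) : 0 <= lambda k by case: (run k (ltn_ord k)) => _ [/ltW].
set reg := \sum_(k < T) lambda k * dot (F (x k)) (x k - u).
have gu_reg : Lam * gu <= reg.
  have -> : Lam * gu = \sum_(k < T) lambda k * dot (F u) (x k - u).
    rewrite /gu /viji_average dotDr dotZr mulrDr mulrA divff ?gt_eqF// mul1r.
    rewrite dot_sumr /Lam mulr_suml -big_split; apply: eq_bigr => k _ /=.
    by rewrite dotZr dotDr mulrDr.
  apply: ler_sum => k _; rewrite ler_wpM2l// -subr_ge0.
  have [[_ _ Zx _] _] := run k (ltn_ord k).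
  by have := monoF Zx Zu; rewrite dotDl dotNl.
have := viji_regret sigma0 run model Zu; rewrite -/reg.
set Q := \sum_(k < T) _ => regret.
have Q0 : 0 <= Q by apply: sumr_ge0 => k _; exact: sqr_ge0.
have uz0 : enorm (u - z0) ^+ 2 <= D ^+ 2.
  by rewrite lerXn2r ?nnegrE ?enorm_ge0// enorm_le_diameter.
(* The regret bound controls [Q] only when [reg] is nonnegative, which holds in
   the one case where there is something to prove. *)
have [gu0|gu0] := leP gu 0.
  by apply: (le_trans gu0); rewrite divr_ge0 ?sqr_ge0// mulr_ge0// mulr_ge0 ?sqr_ge0.
have reg0 : 0 <= reg by apply: le_trans gu_reg; rewrite mulr_ge0 ?ltW.
have Q_le : Q <= 4 * D ^+ 2 by lra.
have r_le : \sum_(k < T) enorm (x k - v k) <= 2 * D * Num.sqrt T%:R.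
  rewrite -ler_sqr ?nnegrE; last 2 first.
    by apply: sumr_ge0 => k _; exact: enorm_ge0.
    by rewrite !mulr_ge0 ?sqrtr_ge0.
  apply: le_trans (sum_sq_le _) _; rewrite -/Q !exprMn sqr_sqrtr ?(ltW TR)//.
  by rewrite mulrC ler_wpM2r ?(ltW TR)// -natrX.
have Gam_le : Gam <= L * D * Num.sqrt T%:R + delta * T%:R.
  rewrite /Gam big_split /= -mulr_sumr sumr_const card_ord mulr_natr lerD2r.
  have := ler_wpM2l (ltW L_gt0) r_le; lra.
have Lgu : Lam * gu <= D ^+ 2 / 2 by lra.
rewrite ler_pdivlMr ?exprn_gt0//.
apply: (@le_trans _ _ (32 * Gam * (Lam * gu))).
  by have := ler_wpM2l (ltW gu0) TLG; lra.
apply: (@le_trans _ _ (16 * D ^+ 2 * Gam)); last first.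
  by rewrite ler_wpM2l// mulr_ge0 ?sqr_ge0.
by have := ler_wpM2l Gam0 Lgu; lra.
Qed.

(** A zero bracket annihilates the right-hand side of [viji_model_gap], so [x k]
solves the variational inequality. *)
Lemma viji_stop_gap k : inner k ->
  opnorm (DF (v k) - J k) <= delta ->
  viji_bracket L (fun=> delta) v x k = 0 -> gap Z F (x k) <= 0.
Proof.
move=> [Zv _ Zx xinex] model bracket0.
apply: ge_sup => [|_ [u Zu <-]].
  by have [p Zp] := Z0; exists (dot (F p) (x k - p)); exists p.
have := viji_model_gap Zv Zx Zu model xinex.
rewrite /viji_bracket in bracket0; rewrite bracket0 mul0r.
by have := monoF Zx Zu; rewrite dotDl dotNl; lra.
Qed.

Lemma rate_le (D T : R) : 0 <= D -> 0 < T ->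
  16 * D ^+ 2 * (L * D * Num.sqrt T + delta * T) / T ^+ 2
  <= 16 * Num.sqrt 2 * L * D ^+ 3 / (T `^ (3 / 2))
     + 16 * Num.sqrt 2 * delta * D ^+ 2 / T.
Proof.
move=> D0 T0.
have sT : Num.sqrt T ^+ 2 = T by rewrite sqr_sqrtr ?ltW.
have sT0 : 0 < Num.sqrt T by rewrite sqrtr_gt0.
have -> : T `^ (3 / 2) = T * Num.sqrt T.
  have -> : 3 / 2 = 1 + 2^-1 :> R by field.
  by rewrite powRD ?powRr1 ?powR12_sqrt ?(ltW T0)// gt_eqF ?implybT.
have s2 : 1 <= Num.sqrt 2 :> R by rewrite -[leLHS]sqrtr1 ler_wsqrtr// ler1n.
have -> : 16 * D ^+ 2 * (L * D * Num.sqrt T + delta * T) / T ^+ 2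
  = 16 * L * D ^+ 3 / (T * Num.sqrt T) + 16 * delta * D ^+ 2 / T.
  move: sT sT0; move: (Num.sqrt T) => s <- s0.
  by field; rewrite gt_eqF.
have A0 : 0 <= 16 * L * D ^+ 3 / (T * Num.sqrt T).
  by rewrite divr_ge0 ?mulr_ge0 ?exprn_ge0 ?(ltW L_gt0) ?(ltW T0) ?(ltW sT0).
have B0 : 0 <= 16 * delta * D ^+ 2 / T.
  by rewrite divr_ge0 ?mulr_ge0 ?exprn_ge0 ?(ltW T0).
have := ler_wpM2r A0 s2; have := ler_wpM2r B0 s2; lra.
Qed.

Lemma viji_gap T N zT : (0 < T)%N ->
  viji_output Z F L delta (fun=> delta) J z0 sigma v x lambda T N zT ->
  (forall k, (k < N)%N -> opnorm (DF (v k) - J k) <= delta) ->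
  gap Z F zT <= 16 * Num.sqrt 2 * L * diameter Z ^+ 3 / (T%:R `^ (3 / 2))
                + 16 * Num.sqrt 2 * delta * diameter Z ^+ 2 / T%:R.
Proof.
move=> T0 out model; have TR : 0 < T%:R :> R by rewrite ltr0n.
have [p Zp] := Z0.
have D0 : 0 <= diameter Z :=
  le_trans (enorm_ge0 _) (enorm_le_diameter compactZ Zp Zp).
apply: le_trans (rate_le D0 TR).
case: out model => [Zz0 sigma0 run model|k _ _ _ _ innerk bracket0 model].
  exact: viji_complete_gap.
apply: le_trans (viji_stop_gap innerk (model k (ltnSn k)) bracket0) _.
rewrite divr_ge0 ?sqr_ge0// mulr_ge0// ?mulr_ge0 ?sqr_ge0//.
by rewrite addr_ge0 ?mulr_ge0 ?sqrtr_ge0// ltW.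
Qed.

End VijiConvergence.

Lemma viji_output_mem (R : realType) (d : nat) (Z : set 'cV[R]_d) F L delta rho J
    z0 sigma v x lambda T N zT :
  viji_output Z F L delta rho J z0 sigma v x lambda T N zT ->
  forall k, (k < N)%N -> Z (v k).
Proof.
case=> [_ _ run k /run[[]]//|k _ _ _ run [Zv _ _ _] _ j].
by rewrite ltnS leq_eqVlt => /predU1P[->//|/run[[]]].
Qed.

Lemma opnorm_sub_projection (R : realType) (d : nat) (Z : set 'cV[R]_d) G beta
    (A B : 'M[R]_d) :
  opnorm A <= beta -> projected_secant_approx Z G beta B ->
  opnorm (A - B) <= 2 * beta.
Proof.
move=> Ab [m [a [b [Sp [_ _ [/= Bb _]]]]]].
by apply: le_trans (opnormB _ _) _; rewrite mulr_natl mulr2n lerD.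
Qed.

Unset Implicit Arguments.
Set Strict Implicit.

Theorem proposition2 (R : realType) (d n : nat) (Z : set 'cV[R]_d)
    (w : 'I_n.+1 -> R) (Fi : 'I_n.+1 -> 'cV[R]_d -> 'cV[R]_d)
    (DFi : 'I_n.+1 -> 'cV[R]_d -> 'M[R]_d) (L1 : R) :
  let F := mixture w Fi in
  let DF := mixture w DFi in
  let F1 := Fi ord0 in
  let DF1 := DFi ord0 in
  let G := fun z => F z - F1 z in
  let D := diameter Z in
  let beta := dissimilarity Z DF DF1 in
  Z !=set0 -> compact Z -> convex_set (Z : set (convex_lmodType 'cV[R]_d)) ->
  (forall i, 0 < w i) -> \sum_i w i = 1 ->
  (forall i, C1_on Z (Fi i) (DFi i)) ->
  monotone_on Z F ->
  0 < L1 -> jacobian_lipschitz_on Z DF L1 ->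
  [/\ forall (T : nat) (delta : R) (B : nat -> 'M[R]_d) (z0 : 'cV[R]_d)
        (sigma v x : nat -> 'cV[R]_d) (lambda : nat -> R)
        (N : nat) (zT : 'cV[R]_d),
        (1 <= T)%N -> 0 <= delta ->
        viji_output Z F L1 delta (fun=> delta) (fun k => DF1 (v k) + B k) z0
          sigma v x lambda T N zT ->
        (forall k, (k < N)%N ->
           opnorm ((DF (v k) - DF1 (v k)) - B k) <= delta) ->
        gap Z F zT <= 16 * Num.sqrt 2 * L1 * D ^+ 3 / (T%:R `^ (3 / 2))
                      + 16 * Num.sqrt 2 * delta * D ^+ 2 / T%:R,
      forall (u : 'cV[R]_d) (B : 'M[R]_d),
        Z u -> projected_secant_approx Z G beta B ->
        opnorm ((DF u - DF1 u) - B) <= 2 * beta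
    & forall (T : nat) (B : nat -> 'M[R]_d) (z0 : 'cV[R]_d)
        (sigma v x : nat -> 'cV[R]_d) (lambda : nat -> R)
        (N : nat) (zT : 'cV[R]_d),
        (1 <= T)%N ->
        viji_output Z F L1 (2 * beta) (fun=> 2 * beta)
          (fun k => DF1 (v k) + B k) z0 sigma v x lambda T N zT ->
        (forall k, (k < N)%N -> projected_secant_approx Z G beta (B k)) ->
        gap Z F zT <= 16 * Num.sqrt 2 * L1 * D ^+ 3 / (T%:R `^ (3 / 2))
                      + 32 * Num.sqrt 2 * beta * D ^+ 2 / T%:R].
Proof.
move=> F DF F1 DF1 G D beta Z0 cZ cvxZ w0 w1 C1 monoF L0 DFL.
have taylor z y : Z z -> Z y ->
    enorm (F y - F z - DF z *m (y - z)) <= L1 / 2 * enorm (y - z) ^+ 2.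
  apply: jacobian_taylor => //; last exact: ltW.
  by apply: C1_on_mixture => // i; exact: ltW.
have rate : forall (T : nat) (delta : R) (B : nat -> 'M[R]_d) z0 sigma v x
    lambda N zT, (1 <= T)%N -> 0 <= delta ->
    viji_output Z F L1 delta (fun=> delta) (fun k => DF1 (v k) + B k) z0
      sigma v x lambda T N zT ->
    (forall k, (k < N)%N -> opnorm ((DF (v k) - DF1 (v k)) - B k) <= delta) ->
    gap Z F zT <= 16 * Num.sqrt 2 * L1 * D ^+ 3 / (T%:R `^ (3 / 2))
                  + 16 * Num.sqrt 2 * delta * D ^+ 2 / T%:R.
  move=> T delta B z0 sigma v x lambda N zT T0 delta0 out model.
  apply: (viji_gap cZ Z0 cvxZ monoF L0 delta0 taylor T0 out) => k kN.
  by rewrite opprD addrA model.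
have ubeta : has_ubound [set opnorm (DF z - DF1 z) | z in Z].
  exact: (dissimilarity_has_ubound cZ Z0 L0 DFL (C1 ord0).2).
have secant : forall (u : 'cV[R]_d) (B : 'M[R]_d),
    Z u -> projected_secant_approx Z G beta B ->
    opnorm ((DF u - DF1 u) - B) <= 2 * beta.
  move=> u B Zu; apply: opnorm_sub_projection.
  by apply: (ub_le_sup ubeta); exists u.
split=> // T B z0 sigma v x lambda N zT T0 out proj.
have beta0 : 0 <= 2 * beta by rewrite mulr_ge0// dissimilarity_ge0.
have -> : 32 * Num.sqrt 2 * beta * D ^+ 2 / T%:R
  = 16 * Num.sqrt 2 * (2 * beta) * D ^+ 2 / T%:R :> R by congr (_ / _); ring.
apply: (rate T (2 * beta) B _ _ _ _ _ _ _ T0 beta0 out) => k kN.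
by apply: secant (proj k kN); exact: viji_output_mem out k kN.
Qed.
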